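(* Let $M,N,p\ge1$ be integers. Any finite-dimensional irreducible representation of the superalgebra $\mathcal W_p(M|N)$ is highest weight, and it has a unique (up to scalar multiplication) highest weight vector.
   Context: Grading: $[a]=0$ for $1\le a\le M$, $[a]=1$ for $M<a\le M+N$. The super-Yangian $Y(M|N)=Y(gl(M|N))$ is the associative unital $\mathbb Z_2$-graded algebra over $\mathbb C$ generated by $T^{ab}_{(n)}$, $1\le a,b\le M+N$, $n\ge1$, of parity $[a]+[b]$, with relations ($[\cdot,\cdot\}$ the graded commutator) $$[T^{ab}_{(m)},T^{cd}_{(n)}\}=\delta^{cb}T^{ad}_{(m+n-1)}-(-1)^{([a]+[b])([c]+[d])}\delta^{ad}T^{cb}_{(m+n-1)}+(-1)^{[c]([a]+[b])+[a][b]}\sum_{r=1}^{\min(m,n)-1}\big(T^{cb}_{(r)}T^{ad}_{(m+n-1-r)}-T^{cb}_{(m+n-1-r)}T^{ad}_{(r)}\big).$$ The truncated super-Yangian $Y_p(M|N)$ is the quotient of $Y(M|N)$ by the ideal generated by all $T^{ab}_{(n)}$ with $n>p$. For representation theory, $\mathcal W_p(M|N)=\mathcal W(gl(Mp|Np),(M+N)gl(p))$ means the (quantum) superalgebra $Y_p(M|N)$, with generators $W^{ab}_{r-1}\leftrightarrow T^{ab}_{(r)}$, $1\le r\le p$. Put $n=\lfloor N/2\rfloor$ and let $\Phi^+$ be the set of pairs $(a,b)$ with either $1\le a<b\le M$; or $M+1\le a<b\le M+N$; or $1\le a\le M$ and $M+n+1\le b\le M+N$; or $M+1\le a\le M+n$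 and $1\le b\le M$. A highest weight vector of a representation $V$ is a nonzero $v\in V$ with $T^{ab}_{(r)}v=0$ for all $(a,b)\in\Phi^+$, $r>0$, and $T^{aa}_{(r)}v=\lambda_a^{(r)}v$ with $\lambda_a^{(r)}\in\mathbb C$ for all $a$, $r>0$. An irreducible representation is called highest weight if it admits a highest weight vector. *)

(* Defs.v *)
From HB Require Import structures.
From mathcomp Require Import all_boot all_order all_algebra.
From mathcomp Require Import generic_quotient ring_quotient finmap.
From mathcomp Require Import boolp reals.
From mathcomp Require Import complex.
From mathcomp.multinomials Require Import monalg.

Set Implicit Arguments.
Unset Strict Implicit.
Unset Printing Implicit Defensive.

Import GRing.Theory.

Local Open Scope ring_scope.
Local Open Scope quotient_scope.

(* The monoid algebra of the free monoid on [I] is only an [lalgType] in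
   [monalg]; the alias carries the missing [algType] structure. *)

Definition free_alg (K : fieldType) (I : choiceType) := {malg K[{fmonom I}]}.

Section FreeAlgebra.
Variables (K : fieldType) (I : choiceType).

HB.instance Definition _ := GRing.Lalgebra.on (free_alg K I).

Lemma free_alg_scaleAr (c : K) (x y : {malg K[{fmonom I}]}) :
  c *: (x * y) = x * (c *: y).
Proof.
apply/malgP => k; rewrite mcoeffZ.
have sub : (msupp (c *: y) `<=` msupp y)%fset.
  apply/fsubsetP => w; rewrite -!mcoeff_neq0 mcoeffZ.
  by apply: contra => /eqP ->; rewrite mulr0.
rewrite (mcoeffMl x y k) (mcoeffMlw k (fsubset_refl (msupp x)) sub) mulr_sumr.
apply: eq_bigr => k1 _; rewrite mulr_sumr; apply: eq_bigr => k2 _.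
by rewrite mcoeffZ mulrnAr mulrCA.
Qed.

HB.instance Definition _ :=
  GRing.Lalgebra_isAlgebra.Build K (free_alg K I) free_alg_scaleAr.

Definition free_gen (i : I) : free_alg K I := << fmu i >>.

Definition free_aug : {rmorphism free_alg K I -> K} := mcoeff (@mone {fmonom I}).

Lemma free_aug_gen (i : I) : free_aug (free_gen i) = 0.
Proof. by rewrite /free_aug /free_gen /= mcoeffU1 fmP fmU fm1. Qed.

End FreeAlgebra.

Inductive ideal_gen (A : nzRingType) (S : A -> Prop) : A -> Prop :=
| ideal_gen_in x : S x -> ideal_gen S x
| ideal_gen0 : ideal_gen S 0
| ideal_genB x y : ideal_gen S x -> ideal_gen S y -> ideal_gen S (x - y)
| ideal_genM a x b : ideal_gen S x -> ideal_gen S (a * x * b).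

Section IdealPred.
Variables (A : nzRingType) (S : A -> Prop).

Definition ideal_pred : {pred A} := fun x => `[< ideal_gen S x >].

Lemma ideal_predP x : reflect (ideal_gen S x) (x \in ideal_pred).
Proof. exact: asboolP. Qed.

Lemma ideal_pred_zmod : zmod_closed ideal_pred.
Proof.
split; first by apply/ideal_predP; exact: ideal_gen0.
by move=> x y /ideal_predP Sx /ideal_predP Sy; apply/ideal_predP/ideal_genB.
Qed.

HB.instance Definition _ := GRing.isZmodClosed.Build A ideal_pred ideal_pred_zmod.

Lemma ideal_predMl a x : x \in ideal_pred -> a * x \in ideal_pred.
Proof.
by move/ideal_predP => Sx; apply/ideal_predP; rewrite -[_ * _]mulr1; exact: ideal_genM.
Qed.

Lemma ideal_predMr x b : x \in ideal_pred -> x * b \in ideal_pred.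
Proof.
by move/ideal_predP => Sx; apply/ideal_predP; rewrite -[x]mul1r; exact: ideal_genM.
Qed.

End IdealPred.

Lemma ideal_gen_ker (A B : nzRingType) (f : {rmorphism A -> B}) (S : A -> Prop) :
  (forall x, S x -> f x = 0) -> forall x, ideal_gen S x -> f x = 0.
Proof.
move=> fS x; elim=> {x} [x /fS // | | x y _ fx _ fy | a x b _ fx].
- exact: rmorph0.
- by rewrite rmorphB fx fy subrr.
- by rewrite !rmorphM fx mulr0 mul0r.
Qed.

Lemma ideal_gen_proper (A B : nzRingType) (f : {rmorphism A -> B})
    (S : A -> Prop) :
  (forall x, S x -> f x = 0) -> ~ ideal_gen S 1.
Proof.
move=> fS /(ideal_gen_ker fS)/eqP; rewrite rmorph1; apply/negP/oner_neq0.
Qed.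

(* [S1] makes the quotient a nonzero ring, as MathComp's [algType] demands. *)
Definition alg_quot (K : fieldType) (A : algType K) (S : A -> Prop)
  (S1 : ~ ideal_gen S 1) : Type := Quotient.quot (ideal_pred S).

Section AlgQuotient.
Variables (K : fieldType) (A : algType K) (S : A -> Prop).
Variable S1 : ~ ideal_gen S 1.
Local Notation Q := (alg_quot S1).

HB.instance Definition _ := GRing.Zmodule.on Q.

Definition qproj (x : A) : Q := \pi_(Quotient.quot (ideal_pred S)) x.

Definition qrepr (y : Q) : A := repr (y : Quotient.quot (ideal_pred S)).

Lemma qreprK : cancel qrepr qproj.
Proof. by move=> y; rewrite /qproj /qrepr reprK. Qed.

Lemma qproj_eq x y : qproj x = qproj y <-> ideal_gen S (x - y).
Proof.
split=> [/eqP | H]; last apply/eqP; rewrite /qproj piE Quotient.equivE.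
  by move/ideal_predP.
exact/ideal_predP.
Qed.

Lemma qprojB : {morph qproj : x y / x - y}.
Proof. exact: (raddfB (\pi_(Quotient.quot (ideal_pred S)))). Qed.

Definition qone : Q := qproj 1.
Definition qmul (x y : Q) : Q := qproj (qrepr x * qrepr y).
Definition qscale (c : K) (x : Q) : Q := qproj (c *: qrepr x).

Lemma qrepr_proj x : ideal_gen S (qrepr (qproj x) - x).
Proof. by apply/qproj_eq; rewrite qreprK. Qed.

Lemma qprojM_subproof x y : qmul (qproj x) (qproj y) = qproj (x * y).
Proof.
apply/qproj_eq/ideal_predP; set x' := qrepr _; set y' := qrepr _.
have -> : x' * y' - x * y = (x' - x) * y' + x * (y' - y).
  by rewrite mulrBl mulrBr addrA subrK.
apply: rpredD; [apply: ideal_predMr | apply: ideal_predMl];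
  exact/ideal_predP/qrepr_proj.
Qed.

Lemma qprojZ_subproof c x : qscale c (qproj x) = qproj (c *: x).
Proof.
apply/qproj_eq/ideal_predP; rewrite -scalerBr -[_ - x]mul1r scalerAl.
exact/ideal_predMl/ideal_predP/qrepr_proj.
Qed.

Lemma qprojD : {morph qproj : x y / x + y}.
Proof.
move=> x y; have N z : qproj (- z) = - qproj z.
  by rewrite -sub0r qprojB -[X in qproj X](subrr 0) qprojB subrr sub0r.
by rewrite -[y in LHS]opprK qprojB N opprK.
Qed.

Let qprojE := (qprojM_subproof, qprojZ_subproof).

Lemma qind (P : Q -> Prop) : (forall x, P (qproj x)) -> forall y, P y.
Proof. by move=> H y; rewrite -[y]qreprK. Qed.

Lemma qmulA : associative qmul.
Proof. by elim/qind=> x; elim/qind=> y; elim/qind=> z; rewrite !qprojE mulrA. Qed.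
Lemma qmul1 : left_id qone qmul.
Proof. by elim/qind=> x; rewrite !qprojE mul1r. Qed.
Lemma qmulr1 : right_id qone qmul.
Proof. by elim/qind=> x; rewrite !qprojE mulr1. Qed.
Lemma qmulDl : left_distributive qmul +%R.
Proof.
by elim/qind=> x; elim/qind=> y; elim/qind=> z; rewrite -qprojD !qprojE mulrDl qprojD.
Qed.
Lemma qmulDr : right_distributive qmul +%R.
Proof.
by elim/qind=> x; elim/qind=> y; elim/qind=> z; rewrite -qprojD !qprojE mulrDr qprojD.
Qed.
Lemma qone_neq0 : qone != 0.
Proof.
apply/eqP => h; apply: S1; rewrite -[1]subr0; apply/qproj_eq.
by rewrite -/qone h -[0 in RHS]subr0 qprojB subrr.
Qed.

HB.instance Definition _ :=
  GRing.Zmodule_isNzRing.Build Q qmulA qmul1 qmulr1 qmulDl qmulDr qone_neq0.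

Lemma qscaleA a b x : qscale a (qscale b x) = qscale (a * b) x.
Proof. by elim/qind: x => x; rewrite !qprojE scalerA. Qed.
Lemma qscale1 : left_id 1 qscale.
Proof. by elim/qind=> x; rewrite !qprojE scale1r. Qed.
Lemma qscaleDr : right_distributive qscale +%R.
Proof.
by move=> c; elim/qind=> x; elim/qind=> y; rewrite -qprojD !qprojE scalerDr qprojD.
Qed.
Lemma qscaleDl x : {morph qscale^~ x : a b / a + b}.
Proof. by move=> a b; elim/qind: x => x; rewrite !qprojE scalerDl qprojD. Qed.

HB.instance Definition _ :=
  GRing.Zmodule_isLmodule.Build K Q qscaleA qscale1 qscaleDr qscaleDl.

Lemma qscaleAl (c : K) (x y : Q) : c *: (x * y) = (c *: x) * y.
Proof.
by elim/qind: x => x; elim/qind: y => y; rewrite /GRing.scale /GRing.mul /= !qprojE scalerAl.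
Qed.
HB.instance Definition _ := GRing.Lmodule_isLalgebra.Build K Q qscaleAl.
Lemma qscaleAr (c : K) (x y : Q) : c *: (x * y) = x * (c *: y).
Proof.
by elim/qind: x => x; elim/qind: y => y; rewrite /GRing.scale /GRing.mul /= !qprojE scalerAr.
Qed.
HB.instance Definition _ := GRing.Lalgebra_isAlgebra.Build K Q qscaleAr.

Lemma qproj_is_zmod_morphism : zmod_morphism qproj.
Proof. exact: qprojB. Qed.
HB.instance Definition _ :=
  GRing.isZmodMorphism.Build A Q qproj qproj_is_zmod_morphism.
Lemma qproj_is_monoid_morphism : monoid_morphism qproj.
Proof. by split=> // x y; rewrite -qprojM_subproof. Qed.
HB.instance Definition _ :=
  GRing.isMonoidMorphism.Build A Q qproj qproj_is_monoid_morphism.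
Lemma qproj_is_scalable : scalable qproj.
Proof. by move=> c x; rewrite -qprojZ_subproof. Qed.
HB.instance Definition _ := GRing.isScalable.Build K A Q *:%R qproj qproj_is_scalable.

Section Lift.
Variables (B : nzRingType) (f : {rmorphism A -> B}).
Hypothesis fS : forall x, S x -> f x = 0.

Lemma qlift_ex : exists g : {rmorphism Q -> B}, forall x, g (qproj x) = f x.
Proof.
pose g (y : Q) := f (qrepr y).
have gE x : g (qproj x) = f x.
  by apply/eqP; rewrite -subr_eq0 -rmorphB; apply/eqP/(ideal_gen_ker fS)/qrepr_proj.
have gB : zmod_morphism g.
  by elim/qind=> x; elim/qind=> y; rewrite -rmorphB !gE rmorphB.
have gM : monoid_morphism g.
  split; first by rewrite -(rmorph1 qproj) gE rmorph1.
  by elim/qind=> x; elim/qind=> y; rewrite -rmorphM !gE rmorphM.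
pose ga := GRing.isZmodMorphism.Build _ _ g gB.
pose gm := GRing.isMonoidMorphism.Build _ _ g gM.
pose G : {rmorphism Q -> B} := HB.pack g ga gm.
by exists G.
Qed.

End Lift.
End AlgQuotient.


Section SuperYangian.
Variables (K : fieldType) (M N : nat).
Implicit Types a b c d : 'I_(M + N).

(* Indices are shifted down by one: [a : 'I_(M + N)] stands for the index
   [a + 1] of [1..M+N]. *)
Definition par a : bool := (M <= a)%N.

(* [(a, b, k)] labels the generator [T^{ab}_(k+1)]. *)
Definition Tindex : choiceType := ('I_(M + N) * 'I_(M + N) * nat)%type.

Definition Tpar (g : Tindex) : nat := (par g.1.1 + par g.1.2)%N.

Section Relations.
Variables (A : algType K) (T : 'I_(M + N) -> 'I_(M + N) -> nat -> A).

Definition Tcomm a b m c d n : A :=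
  T a b m * T c d n
  - (-1) ^+ ((par a + par b) * (par c + par d))%N * (T c d n * T a b m).

Definition Trhs a b m c d n : A :=
  (c == b)%:R * T a d (m + n - 1)%N
  - (-1) ^+ ((par a + par b) * (par c + par d))%N
      * (a == d)%:R * T c b (m + n - 1)%N
  + (-1) ^+ (par c * (par a + par b) + par a * par b)%N
      * \sum_(1 <= r < minn m n)
          (T c b r * T a d (m + n - 1 - r)%N
           - T c b (m + n - 1 - r)%N * T a d r).

Definition yangian_rel (x : A) : Prop :=
  exists a b c d m n,
    [/\ (0 < m)%N, (0 < n)%N & x = Tcomm a b m c d n - Trhs a b m c d n].

Lemma yangian_rel_eq0 (B : nzRingType) (f : {rmorphism A -> B}) :
  (forall a b n, f (T a b n) = 0) -> forall x, yangian_rel x -> f x = 0.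
Proof.
move=> T0 x [a [b [c [d [m [n [_ _ ->]]]]]]]; rewrite /Tcomm /Trhs.
rewrite !(rmorphB, rmorphD, rmorphM) !T0 !mulr0 !subr0 !add0r rmorph_sum big1.
  by rewrite mulr0 oppr0.
by move=> r _; rewrite rmorphB !rmorphM !T0 !mulr0 subr0.
Qed.

End Relations.

Section RelationsMorph.
Variables (A B : algType K) (T : 'I_(M + N) -> 'I_(M + N) -> nat -> A).
Variable f : {rmorphism A -> B}.
Local Notation fT := (fun a b n => f (T a b n)).

Lemma Tcomm_morph a b m c d n : f (Tcomm T a b m c d n) = Tcomm fT a b m c d n.
Proof. by rewrite /Tcomm rmorphB !rmorphM rmorph_sign. Qed.

Lemma Trhs_morph a b m c d n : f (Trhs T a b m c d n) = Trhs fT a b m c d n.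
Proof.
rewrite /Trhs rmorphD rmorphB !rmorphM !rmorph_sign !rmorph_nat rmorph_sum.
congr (_ + _ * _); apply: eq_bigr => r _.
by rewrite rmorphB !rmorphM.
Qed.

End RelationsMorph.

(* [T^{ab}_(n)], meaningful for [n > 0] only. *)
Definition freeT a b (n : nat) : free_alg K Tindex := free_gen K (a, b, n.-1).

Lemma yangian_rel_aug x : yangian_rel freeT x -> free_aug K Tindex x = 0.
Proof. by apply: yangian_rel_eq0 => a b n; exact: free_aug_gen. Qed.

Definition yangian_proper : ~ ideal_gen (yangian_rel freeT) 1 :=
  ideal_gen_proper yangian_rel_aug.

Definition superYangian : algType K := alg_quot yangian_proper.

Definition yangT a b n : superYangian := qproj yangian_proper (freeT a b n).

Lemma yangTP a b m c d n : (0 < m)%N -> (0 < n)%N ->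
  Tcomm yangT a b m c d n = Trhs yangT a b m c d n.
Proof.
move=> m0 n0; have: qproj yangian_proper (Tcomm freeT a b m c d n) =
    qproj yangian_proper (Trhs freeT a b m c d n).
  by apply/qproj_eq; apply: ideal_gen_in; exists a, b, c, d, m, n.
by rewrite (Tcomm_morph freeT (qproj yangian_proper))
  (Trhs_morph freeT (qproj yangian_proper)).
Qed.

Definition trunc_rel (p : nat) (x : superYangian) : Prop :=
  exists a b n, (p < n)%N /\ x = yangT a b n.

Lemma trunc_proper (p : nat) : ~ ideal_gen (trunc_rel p) 1.
Proof.
have [g gE] := qlift_ex yangian_proper yangian_rel_aug.
apply: (@ideal_gen_proper _ _ g) => _ [a [b [n [_ ->]]]].
by rewrite gE; exact: free_aug_gen.
Qed.

(* [W_p(M|N)] is by definition the truncated super-Yangian [Y_p(M|N)]. *)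
Definition Walg (p : nat) : algType K := alg_quot (@trunc_proper p).

Definition WT p a b n : Walg p := qproj (@trunc_proper p) (yangT a b n).

Lemma WT_trunc p a b n : (p < n)%N -> WT p a b n = 0.
Proof.
move=> ltpn; rewrite -(raddf0 (qproj (@trunc_proper p))); apply/qproj_eq.
by apply: ideal_gen_in; exists a, b, n; rewrite subr0.
Qed.

(* The Z/2-grading of [W_p(M|N)] induced by the parities of the generators. *)
Definition homogeneous p (i : bool) (x : Walg p) : Prop :=
  exists2 f : free_alg K Tindex,
    forall w : {fmonom Tindex}, w \in msupp f ->
      odd (\sum_(g <- (w : seq Tindex)) Tpar g)%N = i
    & x = qproj (@trunc_proper p) (qproj yangian_proper f).

End SuperYangian.

Record superspace (K : fieldType) := Superspace {
  sspace :> vectType K;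
  spart : bool -> {vspace sspace};
  spart_sum : (spart false + spart true)%VS = fullv;
  spart_cap : (spart false :&: spart true)%VS = 0%VS
}.

Section Representations.
Variables (K : fieldType) (M N p : nat).

Record super_rep (V : superspace K) := SuperRep {
  rep :> {linear Walg K M N p -> 'End(V)};
  rep1 : rep 1 = \1%VF;
  repM : forall x y, rep (x * y) = (rep x \o rep y)%VF;
  rep_even : forall i j x v,
    homogeneous i x -> v \in spart V j -> rep x v \in spart V (i (+) j)
}.

Variables (V : superspace K) (rho : super_rep V).

Definition subrep (U : {vspace V}) : Prop :=
  (U = (U :&: spart V false) + (U :&: spart V true))%VS
  /\ forall x, (rho x @: U <= U)%VS.

Definition irreducible_rep : Prop :=
  fullv != 0%VS :> {vspace V}
  /\ forall U, subrep U -> U = 0%VS \/ U = fullv.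

Definition Phi_plus (a b : 'I_(M + N)) : bool :=
  let n := N./2 in
  [|| (a < b < M)%N, (M <= a < b)%N, (a < M)%N && (M + n <= b)%N
    | (M <= a < M + n)%N && (b < M)%N].

Definition is_hw_vector (v : V) : Prop :=
  [/\ v != 0,
      forall a b r, Phi_plus a b -> (0 < r)%N -> rho (WT K p a b r) v = 0
    & exists lam : 'I_(M + N) -> nat -> K,
        forall a r, (0 < r)%N -> rho (WT K p a a r) v = lam a r *: v].

Definition highest_weight_rep : Prop := exists v, is_hw_vector v.

End Representations.

(* Main.v *)
Require Import Defs.
From mathcomp Require Import all_boot all_order all_algebra.
From mathcomp Require Import finmap boolp reals complex.
From mathcomp.multinomials Require Import monalg.
From mathcomp Require Import zify.

Set Implicit Arguments.
Unset Strict Implicit.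
Unset Printing Implicit Defensive.

Import GRing.Theory passmx.

Local Open Scope ring_scope.

(** The pairs of [Phi_plus] are exactly the pairs [(a, b)] with [a] before [b]
    for the total order [M+1, ..., M+n, 1, ..., M, M+n+1, ..., M+N] of the
    indices (numbered from 1). So the generators split into raising, diagonal
    and lowering ones, as for a triangular decomposition; the commutation
    relations then give the usual highest weight theory, without a basis theorem
    for the algebra.

    Let [height] be a numerical function decreasing along this order, and let
    the grading element be the sum of the [height a * T^aa_(1)]. Then [T^cd_(r)]
    shifts its eigenvalues by [height c - height d], which is positive for the
    raising generators ([grading_T]).

    Existence ([ex_hw_vector]). The spectrum of the grading element is finite,
    so it has an eigenvalue [x] such that no [x + k], [k >= 1], is an
    eigenvalue; the raising generators kill the eigenvectors for [x]. The space
    of all vectors killed by the raising generators is thus nonzero. The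
    diagonal generators preserve it ([vacuum_diag]) and commute on it
    ([vacuum_comm]): between different indices because, in a suitable one of the
    two forms of each relation, every quadratic term ends with a raising
    generator, and between equal indices by induction on the degrees. Hence they
    have a common eigenvector there.

    Uniqueness. Give [T^ab_(r)] the degree [r]. In a commutation relation all
    correction terms have smaller degree than the two products, so in a word a
    generator can be moved to the right end modulo words of smaller degree.
    Applied to a highest weight vector [v] of grading eigenvalue [x], a word
    therefore reduces by induction on the degree to words in lowering generators
    only ([triangular_word_ind]), so that [v] generates a subspace of the sum of the line
    of [v] and of the generalized eigenspaces for the [x - k], [k >= 1]
    ([hw_words_below]). A highest weight vector has a homogeneous component that
    is a highest weight vector of the same weight ([hw_component]), and a
    homogeneous one generates the whole space by irreducibility
    ([irreducible_cyclic]); it has to be homogeneous, because irreducibility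
    speaks of graded subspaces only. So for two highest weight vectors the
    grading eigenvalue of each is that of the other minus a natural number: they
    are equal, and the second vector lies in the line of a homogeneous first one
    ([hw_vectors_proportional]). *)

(** * Linear algebra *)

Section LinearPredicate.
Variables (K : fieldType) (V : vectType K).

Lemma lfunZD (g : 'End(V)) c u v : g (c *: u + v) = c *: g u + g v.
Proof. exact: linearP. Qed.

Lemma lfunBZ (g : 'End(V)) c u v : g (u - c *: v) = g u - c *: g v.
Proof. by rewrite linearB; congr (_ - _); apply: linearZZ. Qed.

Definition lin_closed (P : V -> Prop) :=
  P 0 /\ forall (c : K) u v, P u -> P v -> P (c *: u + v).

Lemma lin_closedD P : lin_closed P -> forall u v, P u -> P v -> P (u + v).
Proof. by move=> [_ Pl] u v Pu Pv; rewrite -[u]scale1r; apply: Pl. Qed.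

Lemma lin_closedZ P : lin_closed P -> forall (c : K) u, P u -> P (c *: u).
Proof. by move=> [P0 Pl] c u Pu; rewrite -[_ *: u]addr0; apply: Pl. Qed.

Lemma lin_closed_sum P : lin_closed P -> forall (I : eqType) (r : seq I) F,
  (forall i, i \in r -> P (F i)) -> P (\sum_(i <- r) F i).
Proof.
move=> lP I r F; elim: r => [|i r IH] PF; first by rewrite big_nil; case: lP.
rewrite big_cons; apply: lin_closedD => //; first by apply: PF; rewrite mem_head.
by apply: IH => j jr; apply: PF; rewrite inE jr orbT.
Qed.

(** A subspace of largest dimension among those on which [P] holds must
    contain every vector satisfying [P], else it could be enlarged. *)
Lemma vspace_of_pred P : lin_closed P ->
  exists U : {vspace V}, forall u, u \in U <-> P u.
Proof.
move=> lP; pose Q n := `[< exists2 U : {vspace V},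
  \dim U = n & forall u, u \in U -> P u >].
have Q0 : exists n, Q n.
  exists 0%N; apply/asboolP; exists 0%VS; first by rewrite dimv0.
  by move=> u; rewrite memv0 => /eqP ->; case: lP.
have Qle n : Q n -> (n <= \dim {:V})%N.
  by move=> /asboolP[U <- _]; apply/dimvS/subvf.
case: (ex_maxnP Q0 Qle) => n /asboolP[U dimU UP] maxn; exists U => u.
split=> [|Pu]; first exact: UP.
have /maxn : Q (\dim (U + <[u]>)).
  apply/asboolP; exists (U + <[u]>)%VS => // _ /memv_addP[x xU [_ /vlineP[c ->] ->]].
  by rewrite addrC; apply: lP.2 => //; apply: UP.
rewrite -dimU => le_dim.
have /eqP -> : U == (U + <[u]>)%VS by rewrite eqEdim addvSl.
by rewrite (subvP (addvSr _ _)) ?memv_line.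
Qed.

End LinearPredicate.

Section Eigenvectors.
Variables (K : numClosedFieldType) (V : vectType K).

Lemma ex_eigenvector (f : 'End(V)) (U : {vspace V}) :
  U != 0%VS -> (forall u, u \in U -> f u \in U) ->
  exists (a : K) (v : V), [/\ v \in U, v != 0 & f v = a *: v].
Proof.
move=> U0 fU.
pose g : 'End(subvs_of U) := linfun (vsproj U \o f \o vsval).
pose e := vbasis {:subvs_of U}.
have eb : basis_of {:subvs_of U} e by apply: vbasisP.
have d0 : (0 < \dim {:subvs_of U})%N by rewrite dimvf /dim/= lt0n dimv_eq0.
have [a] := eigenvalue_closed (mxof e e g) d0.
rewrite /eigenvalue -(vsof_eq0 eb) -(leigenspaceE eb) -vpick0.
have := memv_pick (leigenspace g a); rewrite memv_ker.
set w := vpick _ => + w0.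
rewrite !lfun_simp subr_eq0 /= => /eqP gw.
exists a, (vsval w); split; first exact: subvsP.
  by rewrite -(inj_eq (@subvs_inj _ _ U)) linear0 in w0.
by rewrite -linearZ -gw /= vsprojK // fU // subvsP.
Qed.

(** If some [F i] is not scalar on [U], one of its eigenspaces cuts [U] down
    to a smaller stable subspace, by commutation. *)
Lemma common_eigenvectors (I : Type) (F : I -> 'End(V)) (U : {vspace V}) :
    U != 0%VS -> (forall i u, u \in U -> F i u \in U) ->
    (forall i j u, u \in U -> F i (F j u) = F j (F i u)) ->
  exists v, [/\ v \in U, v != 0 & forall i, exists a, F i v = a *: v].
Proof.
have [n] := ubnP (\dim U); elim: n U => // n IH U ltU U0 FU FC.
case: (pselect (forall i, exists a, forall u, u \in U -> F i u = a *: u)).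
  move=> sc; exists (vpick U); split; rewrite ?memv_pick ?vpick0 // => i.
  by have [a Fa] := sc i; exists a; rewrite Fa ?memv_pick.
move=> /existsNP[i Ni].
have [a [v [vU v0 Fv]]] := ex_eigenvector U0 (FU i).
pose W := (U :&: leigenspace (F i) a)%VS.
have WE u : (u \in W) = (u \in U) && (F i u == a *: u).
  by rewrite memv_cap memv_ker !lfun_simp subr_eq0.
have sWU : (W <= U)%VS by apply: capvSl.
have [||||v' [v'W v'0 Fv']] := IH W.
- rewrite -ltnS; apply: leq_trans ltU; rewrite ltnS ltn_neqAle dimvS // andbT.
  apply/eqP => dE; apply: Ni; exists a => u.
  have /eqP <- : W == U by rewrite eqEdim sWU dE /=.
  by rewrite WE => /andP[_ /eqP].
- apply: contraNneq v0 => W0; rewrite -memv0 -W0 WE vU Fv eqxx //.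
- move=> j u; rewrite !WE => /andP[uU /eqP Fu].
  by rewrite FU //= FC // Fu linearZ.
- by move=> j k u /(subvP sWU); apply: FC.
by exists v'; split=> //; apply: (subvP sWU).
Qed.

End Eigenvectors.

Section SplitPolynomial.
Variables (K : fieldType) (V : vectType K) (f : 'End(V)).
Implicit Types (s t : seq K) (u v : V).

(** The value at [f] of the polynomial with list of roots [s]. *)
Definition root_prod s : 'End(V) :=
  foldr (fun c g => (g \o (f - c *: \1))%VF) \1%VF s.

Lemma root_prod_cons c s u :
  root_prod (c :: s) u = root_prod s (f u - c *: u).
Proof. by rewrite /= comp_lfunE !lfun_simp /=. Qed.

Lemma root_prod_cat s t u : root_prod (s ++ t) u = root_prod t (root_prod s u).
Proof.
elim: s u => [|c s IH] u; first by rewrite /= lfunE.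
by rewrite cat_cons !root_prod_cons IH.
Qed.

Lemma root_prod_f s u : root_prod s (f u) = f (root_prod s u).
Proof.
elim: s u => [|c s IH] u; first by rewrite /= !lfunE.
by rewrite !root_prod_cons -IH (lfunBZ f).
Qed.

Lemma root_prodC s t u :
  root_prod s (root_prod t u) = root_prod t (root_prod s u).
Proof.
elim: s u => [|c s IH] u; first by rewrite /= !lfunE.
by rewrite !root_prod_cons -IH (lfunBZ (root_prod t)) root_prod_f.
Qed.

Lemma root_prod_cat0 s t u :
  root_prod s u = 0 \/ root_prod t u = 0 -> root_prod (s ++ t) u = 0.
Proof. by rewrite root_prod_cat => -[]; [|rewrite root_prodC] => ->; rewrite linear0. Qed.

Lemma root_prod_eigen (a : K) v s :
  f v = a *: v -> root_prod s v = (\prod_(c <- s) (a - c)) *: v.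
Proof.
move=> fv; elim: s => [|c s IH]; first by rewrite /= lfunE big_nil scale1r.
by rewrite root_prod_cons fv -scalerBl (linearZZ (root_prod s)) /= IH scalerA big_cons.
Qed.

Lemma root_prod_eigen0 (a : K) v s :
  v != 0 -> f v = a *: v -> root_prod s v = 0 -> a \in s.
Proof.
move=> v0 fv; rewrite (root_prod_eigen s fv) => /eqP.
rewrite scaler_eq0 (negPf v0) orbF prodf_seq_eq0 => /hasP[c cs /=].
by rewrite subr_eq0 => /eqP ->.
Qed.

(** From [f g = g (f + e)] follows [P (f - e) g = g P (f)] for every
    polynomial [P]. *)
Lemma root_prod_shift (g : 'End(V)) (e : K) s u :
    (forall w, f (g w) = g (f w) + e *: g w) ->
  root_prod [seq c + e | c <- s] (g u) = g (root_prod s u).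
Proof.
move=> fg; elim: s u => [|c s IH] u; first by rewrite /= !lfunE.
rewrite map_cons !root_prod_cons -IH (lfunBZ g); congr (root_prod _ _).
by rewrite fg scalerDl opprD [- _ - _]addrC addrA addrK.
Qed.

End SplitPolynomial.

Section Spectrum.
Variables (K : numClosedFieldType) (V : vectType K).

(** For an eigenvalue [c] of [f] on [U], the image of [U] under [f - c] is
    stable and of smaller dimension. *)
Lemma ex_root_prod0 (f : 'End(V)) (U : {vspace V}) :
  (forall u, u \in U -> f u \in U) ->
  exists s, forall u, u \in U -> root_prod f s u = 0.
Proof.
have [n] := ubnP (\dim U); elim: n U => // n IH U ltU fU.
have [->|U0] := eqVneq U 0%VS.
  by exists [::] => u; rewrite memv0 => /eqP ->; rewrite linear0.
have [c [v [vU v0 fv]]] := ex_eigenvector U0 fU.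
pose h := f - c *: \1%VF.
have hE u : h u = f u - c *: u by rewrite !lfun_simp.
have dimhU : (\dim (h @: U) < \dim U)%N.
  rewrite -(limg_ker_dim h U) -[X in (X < _)%N]add0n ltn_add2r lt0n dimv_eq0.
  apply: contraNneq v0 => W0.
  by rewrite -memv0 -W0 memv_cap vU memv_ker hE fv subrr eqxx.
have [||s Us] := IH (h @: U)%VS.
- by rewrite -ltnS; apply: leq_trans ltU; rewrite ltnS.
- move=> _ /memv_imgP[u uU ->]; have -> : f (h u) = h (f u).
    by rewrite !hE (lfunBZ f).
  by apply: memv_img; apply: fU.
exists (c :: s) => u uU; rewrite root_prod_cons -hE; apply: Us.
exact: memv_img.
Qed.

Lemma natr_hits_bounded (d : K) (s : seq K) :
  exists B, forall k : nat, d + k%:R \in s -> (k < B)%N.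
Proof.
elim: s => [|c s [B sB]]; first by exists 0%N.
case: (pselect (exists k : nat, d + k%:R = c)) => [[k0 <-]|Nc].
  exists (maxn B k0.+1) => k; rewrite inE (inj_eq (addrI d)) Num.Theory.eqr_nat.
  by case/predU1P => [->|/sB]; rewrite leq_max ?leqnn ?orbT // => ->.
exists B => k; rewrite inE => /predU1P[dk|]; last exact: sB.
by case: Nc; exists k.
Qed.

(** The spectrum is finite and the [d0 + k], for an eigenvalue [d0], are
    distinct in characteristic 0, so a last one among them is an eigenvalue. *)
Lemma ex_top_eigenvalue (f : 'End(V)) : {:V}%VS != 0%VS ->
  exists d : K, (exists2 v, v != 0 & f v = d *: v)
    /\ forall (k : nat) u, (0 < k)%N -> f u = (d + k%:R) *: u -> u = 0.
Proof.
move=> V0; have [s Vs] := @ex_root_prod0 f fullv (fun u _ => memvf _).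
have [d0 [v0 [_ v00 fv0]]] := ex_eigenvector V0 (fun u _ => memvf (f u)).
have [B sB] := natr_hits_bounded d0 s.
pose Q k := `[< exists2 v, v != 0 & f v = (d0 + k%:R) *: v >].
have Q0 : exists k, Q k by exists 0%N; apply/asboolP; exists v0; rewrite ?addr0.
have Qle k : Q k -> (k <= B)%N.
  move=> /asboolP[v vn0 fv]; apply/ltnW/sB.
  by apply: (root_prod_eigen0 vn0 fv); apply: Vs (memvf _).
case: (ex_maxnP Q0 Qle) => m /asboolP Qm maxm; exists (d0 + m%:R); split=> // k u k0.
rewrite -addrA -natrD => fu; apply/eqP/negP => /negP u0.
have : Q (m + k)%N by apply/asboolP; exists u.
by move=> /maxm; rewrite -[X in (_ <= X)%N]addn0 leq_add2l leqNgt k0.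
Qed.

End Spectrum.

(** * The generators acting on a representation *)

Definition swap_sign (K : fieldType) M N (a b c d : 'I_(M + N)) : K :=
  (-1) ^+ ((par a + par b) * (par c + par d))%N.

Definition quad_sign (K : fieldType) M N (a b c : 'I_(M + N)) : K :=
  (-1) ^+ (par c * (par a + par b) + par a * par b)%N.

(** The defining relations of the super-Yangian, read on vectors. The grading
    of the space enters them only through signs of the indices, so that [V] is
    a plain vector space here. *)
Definition yangian_action (K : fieldType) M N (V : vectType K)
    (T : 'I_(M + N) -> 'I_(M + N) -> nat -> 'End(V)) : Prop :=
  forall a b m c d n u, (0 < m)%N -> (0 < n)%N ->
  T a b m (T c d n u) = swap_sign K a b c d *: T c d n (T a b m u)
  + ((c == b)%:R *: T a d (m + n - 1)%N u
     - (swap_sign K a b c d * (a == d)%:R) *: T c b (m + n - 1)%N u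
     + quad_sign K a b c *: \sum_(1 <= r < minn m n)
          (T c b r (T a d (m + n - 1 - r)%N u)
           - T c b (m + n - 1 - r)%N (T a d r u))).

Lemma Trhs_action (K : fieldType) (M N : nat) (A : algType K) (V : vectType K)
    (T : 'I_(M + N) -> 'I_(M + N) -> nat -> A) (phi : {linear A -> 'End(V)}) :
    (forall x y, phi (x * y) = (phi x \o phi y)%VF) ->
    (forall a b m c d n, (0 < m)%N -> (0 < n)%N ->
      Tcomm T a b m c d n = Trhs T a b m c d n) ->
  yangian_action (fun a b n => phi (T a b n)).
Proof.
move=> phiM Trel a b m c d n u m0 n0; move: (Trel a b m c d n m0 n0).
rewrite /Tcomm /Trhs {Trel}.
have signE k (x : A) : (-1) ^+ k * x = ((-1) ^+ k : K) *: x.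
  by rewrite -mulr_algl -in_algE rmorph_sign.
have natE k (x : A) : k%:R * x = (k%:R : K) *: x.
  by rewrite mulr_natl scaler_nat.
have phiE x y : phi (x * y) u = phi x (phi y u) by rewrite phiM comp_lfunE.
have phiB x y : phi (x - y) u = phi x u - phi y u by rewrite linearB !lfun_simp.
have phiD x y : phi (x + y) u = phi x u + phi y u by rewrite linearD !lfun_simp.
have phiZ e x : phi (e *: x) u = e *: phi x u by rewrite linearZZ !lfun_simp.
have phiS (r : seq nat) F : phi (\sum_(i <- r) F i) u = \sum_(i <- r) phi (F i) u.
  by rewrite linear_sum sum_lfunE.
rewrite -mulrA !signE !natE scalerA => /(congr1 (fun x => phi x u)) /=.
rewrite phiB phiD phiB !phiZ phiS !phiE => /eqP; rewrite subr_eq addrC => /eqP ->.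
congr (_ + (_ + _ *: _)); apply: eq_bigr => r _.
by rewrite phiB !phiE.
Qed.

Section Action.
Variables (K : fieldType) (M N : nat) (V : vectType K).
Variable T : 'I_(M + N) -> 'I_(M + N) -> nat -> 'End(V).
Hypothesis T_rel : yangian_action T.
Implicit Types (a b c d : 'I_(M + N)) (u v w : V).

(** With an even element [T a a m] on the left the graded commutator is the
    ordinary one. *)
Lemma T_rel_diag a m c d n u : (0 < m)%N -> (0 < n)%N ->
  T a a m (T c d n u) = T c d n (T a a m u)
  + ((c == a)%:R *: T a d (m + n - 1)%N u - (a == d)%:R *: T c a (m + n - 1)%N u
     + quad_sign K a a c *: \sum_(1 <= r < minn m n)
          (T c a r (T a d (m + n - 1 - r)%N u)
           - T c a (m + n - 1 - r)%N (T a d r u))).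
Proof.
move=> m0 n0; rewrite T_rel //.
have -> : swap_sign K a a c d = 1.
  by rewrite /swap_sign -signr_odd oddM oddD addbb.
by rewrite mul1r scale1r.
Qed.

(** * The positive roots as an order on the indices *)

(** The three ranges [M+1, ..., M+n], then [1, ..., M], then [M+n+1, ..., M+N],
    put one after the other: the multiples of [M + N] make the values on each
    range larger than those on the next one. *)
Definition height a : nat :=
  (if a < M then 2 * (M + N) - a
   else if a < M + N./2 then 3 * (M + N) - a else (M + N) - a)%N.

Lemma Phi_plusE a b : Phi_plus a b = (height b < height a)%N.
Proof.
have := ltn_ord a; have := ltn_ord b; rewrite /Phi_plus /height.
move: (nat_of_ord a) (nat_of_ord b) => i j; have : (N./2 <= N)%N by lia.
by repeat case: ifP; lia.
Qed.

Lemma height_inj : injective height.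
Proof.
move=> a b; have := ltn_ord a; have := ltn_ord b; rewrite /height => la lb eqh.
apply: val_inj; move: eqh la lb => /=; have : (N./2 <= N)%N by lia.
by repeat case: ifP; lia.
Qed.

Lemma height_neq a b : (height a < height b)%N -> (a == b) = false.
Proof. by apply: contraTF => /eqP ->; rewrite ltnn. Qed.

(** * The grading element *)

Definition grading : 'End(V) := \sum_a (height a)%:R *: T a a 1.

Lemma gradingE u : grading u = \sum_a (height a)%:R *: T a a 1 u.
Proof. by rewrite sum_lfunE; apply: eq_bigr => a _; rewrite !lfun_simp. Qed.

(** The degree-one diagonal generators act as a Cartan subalgebra of
    [gl(M|N)], for which all the [T c d n] have weight [e_c - e_d]. *)
Lemma grading_T c d n u : (0 < n)%N ->
  grading (T c d n u)
  = T c d n (grading u) + ((height c)%:R - (height d)%:R) *: T c d n u.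
Proof.
move=> n0; rewrite !gradingE linear_sum /=.
have cartan a : T a a 1 (T c d n u)
    = T c d n (T a a 1 u) + ((c == a)%:R - (a == d)%:R) *: T c d n u.
  rewrite T_rel_diag // (minn_idPl n0) big_geq // scaler0 addr0 add1n subn1 /=.
  by rewrite scalerBl; case: eqP => [->|_]; case: eqP => [->|_]; rewrite ?scale0r.
rewrite (eq_bigr (fun a => T c d n ((height a)%:R *: T a a 1 u)
    + ((height a)%:R * ((c == a)%:R - (a == d)%:R)) *: T c d n u)); last first.
  by move=> a _; rewrite cartan scalerDr scalerA (linearZZ (T c d n)).
rewrite big_split /= -scaler_suml; congr (_ + _ *: _).
under eq_bigr => a _ do rewrite mulrBr !mulr_natr !mulrb.
by rewrite sumrB -!big_mkcond /= big_pred1_eq (big_pred1 c) // => a; rewrite eq_sym.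
Qed.

End Action.

(** * Vectors killed by the positive part *)

Section Vacuum.
Variables (K : fieldType) (M N : nat) (V : vectType K).
Variable T : 'I_(M + N) -> 'I_(M + N) -> nat -> 'End(V).
Hypothesis T_rel : yangian_action T.
Implicit Types (a b c d : 'I_(M + N)) (u v w : V).

Definition vacuum u := forall a b r, Phi_plus a b -> (0 < r)%N -> T a b r u = 0.

Lemma vacuum_lin : lin_closed vacuum.
Proof.
split=> [a b r _ _|e u v uP vP a b r ab r0]; first by rewrite linear0.
by rewrite linearP /= uP // vP // scaler0 addr0.
Qed.

Lemma vacuumP a b r u : vacuum u -> (height b < height a)%N -> (0 < r)%N ->
  T a b r u = 0.
Proof. by move=> uP ab; apply: uP; rewrite Phi_plusE. Qed.

(** For a positive root [(c, d)], one of the two ways of commuting [T c d n]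
    with [T a a m] has all its quadratic terms ending with a positive-root
    generator: those in [T a d] if [a] precedes [d], else those in [T c a]. *)
Lemma vacuum_diag a m u : (0 < m)%N -> vacuum u -> vacuum (T a a m u).
Proof.
move=> m0 uP c d n; rewrite Phi_plusE => dc n0.
have [ad|da] := ltnP (height d) (height a); last first.
  have ac : (height a < height c)%N by apply: leq_ltn_trans da dc.
  rewrite T_rel // (vacuumP uP dc) // linear0 scaler0 add0r.
  rewrite (vacuumP uP ac); last by lia.
  rewrite scaler0 add0r [c == a]eq_sym (height_neq ac) mulr0 scale0r oppr0 add0r.
  rewrite big1_seq ?scaler0 // => r; rewrite mem_index_iota => /andP[_ rP].
  by rewrite !(vacuumP uP ac) ?linear0 ?addr0 //; lia.
have := T_rel_diag T_rel a c d u m0 n0; rewrite (vacuumP uP dc) // linear0.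
rewrite (vacuumP uP ad) ?scaler0 ?add0r; last by lia.
rewrite [a == d]eq_sym (height_neq ad) scale0r oppr0 add0r.
rewrite big1_seq ?scaler0 ?addr0 // => r; rewrite mem_index_iota => /andP[_ rP].
by rewrite !(vacuumP uP ad) ?linear0 ?addr0 //; lia.
Qed.

(** The linear terms cancel and the quadratic ones are commutators of
    [T a a r] and [T a a s] with [min r s < min m n]. *)
Lemma diag_same_comm a m n u : (0 < m)%N -> (0 < n)%N ->
  T a a m (T a a n u) = T a a n (T a a m u).
Proof.
have [k] := ubnP (minn m n); elim: k m n => // k IH m n lek m0 n0.
rewrite T_rel_diag // eqxx scale1r subrr add0r big1_seq ?scaler0 ?addr0 // => r.
rewrite mem_index_iota => /andP[_ rP].
by rewrite IH ?subrr //; lia.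
Qed.

Lemma vacuum_comm a b m n u : vacuum u -> (0 < m)%N -> (0 < n)%N ->
  T a a m (T b b n u) = T b b n (T a a m u).
Proof.
have half a' b' m' n' : vacuum u -> (0 < m')%N -> (0 < n')%N ->
    (height b' < height a')%N -> T a' a' m' (T b' b' n' u) = T b' b' n' (T a' a' m' u).
  move=> uP m0 n0 ba; rewrite T_rel_diag // [a' == b']eq_sym (height_neq ba).
  rewrite !scale0r subrr add0r big1_seq ?scaler0 ?addr0 // => r.
  rewrite mem_index_iota => /andP[_ rP].
  by rewrite !(vacuumP uP ba) ?linear0 ?addr0 //; lia.
move=> uP m0 n0; have [ab|ba|/height_inj ->] := ltngtP (height a) (height b).
- by apply/esym/half.
- exact: half.
exact: diag_same_comm.
Qed.

(** * Words in the generators *)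

Implicit Types (g h : 'I_(M + N) * 'I_(M + N) * nat).

Local Notation word := (seq ('I_(M + N) * 'I_(M + N) * nat)).

(** The label [k] stands for the degree [k + 1], as in the presentation by
    generators and relations. *)
Definition letter g : 'End(V) := T g.1.1 g.1.2 g.2.+1.

Definition act (s : word) u : V :=
  foldr (fun g x => letter g x) u s.

Definition wdeg (s : word) : nat :=
  sumn [seq g.2.+1 | g <- s].

Implicit Types (s t : word).

Lemma act_cat s t u : act (s ++ t) u = act s (act t u).
Proof. by rewrite /act foldr_cat. Qed.

Lemma actD s u v : act s (u + v) = act s u + act s v.
Proof. by elim: s => //= g s ->; rewrite linearD. Qed.

Lemma actZ s (e : K) u : act s (e *: u) = e *: act s u.
Proof. by elim: s => //= g s ->; rewrite linearZZ. Qed.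

Lemma act0 s : act s 0 = 0.
Proof. by elim: s => //= g s ->; rewrite linear0. Qed.

Lemma wdeg_cat s t : wdeg (s ++ t) = (wdeg s + wdeg t)%N.
Proof. by rewrite /wdeg map_cat sumn_cat. Qed.

Lemma wdeg_nil : wdeg [::] = 0%N.
Proof. by []. Qed.

Lemma wdeg_cons g s : wdeg (g :: s) = (g.2.+1 + wdeg s)%N.
Proof. by []. Qed.

Lemma act_T s a b r t u : (0 < r)%N ->
  act s (T a b r (act t u)) = act (s ++ (a, b, r.-1) :: t) u.
Proof. by move=> r0; rewrite act_cat /= /letter /= prednK. Qed.

Section Triangular.
Variables (v : V) (S : V -> Prop).
Hypothesis S_lin : lin_closed S.

(** The correction terms of a commutation relation have smaller degree,
    where [T a b r] has degree [r]. *)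
Lemma act_swap s g h t :
    (forall s', (wdeg s' < wdeg (s ++ g :: h :: t))%N -> S (act s' v)) ->
  S (act (s ++ h :: g :: t) v) -> S (act (s ++ g :: h :: t) v).
Proof.
case: g h => [[a b] m] [[c d] n] IH.
rewrite !act_cat /= {2 4}/letter /= => Shg.
rewrite /letter /= T_rel // actD actZ; apply: S_lin.2 => //.
(* The labels of the two letters add up to [m + n], their degrees to
   [m + n + 2], so [m + n + 1] is one less than what they contribute. *)
have IH' s' : (wdeg s' <= wdeg s + (m + n).+1 + wdeg t)%N -> S (act s' v).
  by move=> le; apply: IH; rewrite wdeg_cat !wdeg_cons /=; lia.
have lin e1 e2 e3 x y z : S (act s x) -> S (act s y) -> S (act s z) ->
    S (act s (e1 *: x - e2 *: y + e3 *: z)).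
  move=> Sx Sy Sz; rewrite -scaleNr !actD !actZ.
  by do 2?[apply: (lin_closedD S_lin)]; apply: (lin_closedZ S_lin).
apply: lin.
- by rewrite act_T; [apply: IH'; rewrite wdeg_cat wdeg_cons /=|]; lia.
- by rewrite act_T; [apply: IH'; rewrite wdeg_cat wdeg_cons /=|]; lia.
suff sumP (F : nat -> V) (r : seq nat) : (forall i, i \in r -> S (act s (F i))) ->
    S (act s (\sum_(i <- r) F i)).
  apply: sumP => r; rewrite mem_index_iota => /andP[r0 rP].
  have pair x1 y1 r1 x2 y2 r2 : (0 < r1)%N -> (0 < r2)%N -> (r1 + r2 <= (m + n).+1)%N ->
      S (act s (T x1 y1 r1 (T x2 y2 r2 (act t v)))).
    move=> r10 r20 le; rewrite -[T x2 _ _ _]/(act [::] _) act_T // act_T //.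
    by apply: IH'; rewrite !(wdeg_cat, wdeg_cons, wdeg_nil) /=; lia.
  rewrite -scaleN1r actD actZ; apply: (lin_closedD S_lin).
    by apply: pair; lia.
  by apply: (lin_closedZ S_lin); apply: pair; lia.
move=> FS; have -> : act s (\sum_(i <- r) F i) = \sum_(i <- r) act s (F i).
  elim: r {FS} => [|i r IHr]; first by rewrite !big_nil act0.
  by rewrite !big_cons actD IHr.
exact: lin_closed_sum.
Qed.

Lemma act_move s g t :
    (forall s', (wdeg s' < wdeg (s ++ g :: t))%N -> S (act s' v)) ->
  S (act (s ++ t ++ [:: g]) v) -> S (act (s ++ g :: t) v).
Proof.
elim: t s => [|h t IHt] s IH //= Sh.
apply: act_swap => //; rewrite -cat_rcons; apply: IHt; last by rewrite cat_rcons.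
move=> s' lt; apply: IH; apply: leq_trans lt _.
by rewrite cat_rcons !wdeg_cat !wdeg_cons; lia.
Qed.

(** Modulo words of smaller degree, a generator can be moved to the right end
    of a word: a positive-root one then kills [v] and a diagonal one acts on it
    by a scalar, both leaving a word of smaller degree; a word in negative-root
    generators only is dealt with one letter at a time. *)
Lemma triangular_word_ind : S v -> vacuum v ->
    (forall a r, (0 < r)%N -> exists e : K, T a a r v = e *: v) ->
    (forall a b r u, (height a < height b)%N -> (0 < r)%N -> S u -> S (T a b r u)) ->
  forall s, S (act s v).
Proof.
move=> Sv vP vD Slow s; have [k] := ubnP (wdeg s); elim: k s => // k IH s lek.
pose low g := (height g.1.1 < height g.1.2)%N.
have [/allP lowP|] := boolP (all low s).
  case: s lek lowP => [//|g s] lek lowP /=.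
  apply: Slow => //; first by apply: lowP; rewrite mem_head.
  by apply: IH; move: lek; rewrite wdeg_cons; lia.
rewrite -has_predC => /hasP[g gs /= ng].
case/splitPr: gs lek => s1 s2 lek.
apply: act_move => [s' lt|]; first exact/IH/(leq_trans lt).
have [e ge] : exists e : K, letter g v = e *: v.
  move: ng; rewrite /low -leqNgt leq_eqVlt => /predU1P[/height_inj E|lt].
    by rewrite /letter E; apply: vD.
  by exists 0; rewrite scale0r /letter vacuumP.
rewrite catA act_cat /= ge actZ; apply: (lin_closedZ S_lin); apply: IH.
by move: lek; rewrite !wdeg_cat wdeg_cons; lia.
Qed.

End Triangular.
End Vacuum.

(** * Highest weight vectors *)

Section HighestWeight.
Variables (K : numClosedFieldType) (M N : nat) (V : vectType K).
Variable T : 'I_(M + N) -> 'I_(M + N) -> nat -> 'End(V).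
Hypothesis T_rel : yangian_action T.
Implicit Types (a b c d : 'I_(M + N)) (u v w : V) (lam : 'I_(M + N) -> nat -> K).

Definition hw_vector lam v :=
  [/\ v != 0, vacuum T v & forall a r, (0 < r)%N -> T a a r v = lam a r *: v].

(** A vector of the topmost eigenspace of the grading element is killed by
    the positive part, which would raise its degree; on the space of all killed
    vectors the diagonal generators commute. *)
Lemma ex_hw_vector : {:V}%VS != 0%VS -> exists lam v, hw_vector lam v.
Proof.
move=> V0; have [x [[u0 u00 Du0] topx]] := ex_top_eigenvalue (grading T) V0.
have [U UP] := vspace_of_pred (vacuum_lin T).
have U0 : U != 0%VS.
  apply: contraNneq u00 => U0; rewrite -memv0 -U0; apply/UP => a b r.
  rewrite Phi_plusE => ba r0; apply: (topx (height a - height b)%N).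
    by rewrite subn_gt0.
  by rewrite grading_T // Du0 linearZZ -scalerDl natrB // ltnW.
pose F (i : 'I_(M + N) * nat) := T i.1 i.1 i.2.+1.
have [||v [vU v0 Fv]] := common_eigenvectors (F := F) U0.
- by move=> i u /UP uP; apply/UP/vacuum_diag.
- by move=> i j u /UP uP; apply: vacuum_comm.
have [lam lamP] := choice Fv.
exists (fun a r => lam (a, r.-1)), v; split=> // [|a r r0]; first exact/UP.
by have := lamP (a, r.-1); rewrite /F /= prednK.
Qed.

Definition hw_degree lam : K := \sum_a (height a)%:R * lam a 1%N.

Lemma grading_hw lam v : hw_vector lam v -> grading T v = hw_degree lam *: v.
Proof.
move=> [_ _ vD]; rewrite gradingE scaler_suml; apply: eq_bigr => a _.
by rewrite vD // scalerA.
Qed.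

(** Membership in the sum of the line of [v] and of the generalized
    eigenspaces of the grading element for [x - 1], [x - 2], and so on. *)
Definition line_and_below (x : K) v u := exists (e : K) (s : seq nat),
  all (leq 1) s /\ root_prod (grading T) [seq x - k%:R | k <- s] (u - e *: v) = 0.

Lemma line_and_below_lin x v : lin_closed (line_and_below x v).
Proof.
split; first by exists 0, [::]; rewrite scale0r subrr linear0.
move=> c u w [e [s [s1 us]]] [f [t [t1 wt]]].
exists (c * e + f), (s ++ t); rewrite all_cat s1 t1 map_cat; split=> //.
have -> : c *: u + w - (c * e + f) *: v = c *: (u - e *: v) + (w - f *: v).
  by rewrite scalerBr scalerA scalerDl opprD addrACA.
rewrite lfunZD !root_prod_cat0 ?scaler0 ?addr0 //; first by right.
by left.
Qed.

Lemma line_and_below_low x v a b r u : grading T v = x *: v ->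
    (height a < height b)%N -> (0 < r)%N ->
  line_and_below x v u -> line_and_below x v (T a b r u).
Proof.
move=> Dv ab r0 [e [s [s1 us]]]; pose j := (height b - height a)%N.
have shift w : grading T (T a b r w) = T a b r (grading T w) + - j%:R *: T a b r w.
  by rewrite grading_T // /j natrB 1?ltnW // opprB.
(* [T a b r] sends [v] to an eigenvector for [x - j], and shifts all roots
   that annihilate the rest of [u] by the same amount. *)
exists 0, ([:: j] ++ [seq (k + j)%N | k <- s]); split.
  rewrite /= subn_gt0 ab all_map; apply: sub_all s1 => k /= k1.
  by rewrite (leq_trans k1) ?leq_addr.
rewrite scale0r subr0; have -> : T a b r u = e *: T a b r v + T a b r (u - e *: v).
  by rewrite lfunBZ addrC subrK.
rewrite map_cat lfunZD !root_prod_cat0 ?scaler0 ?addr0 //; last first.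
  by left; rewrite root_prod_cons shift Dv linearZZ -scalerDl subrr linear0.
right; rewrite -map_comp.
rewrite (eq_map (_ : _ =1 (fun k => k - j%:R) \o (fun k : nat => x - k%:R))); last first.
  by move=> k /=; rewrite natrD opprD addrA.
by rewrite map_comp (root_prod_shift _ _ shift) us linear0.
Qed.

Lemma hw_words_below lam v s : hw_vector lam v ->
  line_and_below (hw_degree lam) v (act T s v).
Proof.
move=> vH; have [v0 vP vD] := vH; apply: triangular_word_ind => //.
- exact: line_and_below_lin.
- by exists 1, [::]; rewrite scale1r subrr linear0.
- by move=> a r r0; exists (lam a r); apply: vD.
by move=> a b r u ab r0; apply/line_and_below_low => //; apply: grading_hw.
Qed.

(** The roots [x - k] that annihilate [u - e *: v], together with the root [x],
    which annihilates [v], annihilate [u]. *)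
Lemma line_and_below_eigen x y v u : grading T v = x *: v -> u != 0 ->
  grading T u = y *: u -> line_and_below x v u -> exists k : nat, y = x - k%:R.
Proof.
move=> Dv u0 Du [e [s [_ us]]].
have : root_prod (grading T) ([seq x - k%:R | k <- s] ++ [:: x - 0%:R]) u = 0.
  rewrite -[u](subrK (e *: v)) [_ - _ + _]addrC lfunZD.
  rewrite !root_prod_cat0 ?scaler0 ?addr0 //; [by left | right].
  by rewrite root_prod_cons Dv subr0 subrr linear0.
rewrite -[[:: _]]/[seq x - k%:R | k <- [:: 0%N]] -map_cat.
by move/(root_prod_eigen0 u0 Du)/mapP => [k _ ->]; exists k.
Qed.

(** The annihilating roots [x - k] have [k >= 1], so [u - e *: v], of eigenvalue
    [x], must vanish. *)
Lemma line_and_below_top x v u : grading T v = x *: v ->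
  grading T u = x *: u -> line_and_below x v u -> exists e : K, u = e *: v.
Proof.
move=> Dv Du [e [s [s1 us]]]; exists e; apply/eqP; rewrite -subr_eq0.
apply/negP => /negP n0.
have Dn : grading T (u - e *: v) = x *: (u - e *: v).
  by rewrite lfunBZ Du Dv scalerBr !scalerA mulrC.
have /mapP[k ks /eqP] := root_prod_eigen0 n0 Dn us.
rewrite eq_sym subr_eq addrC -subr_eq subrr eq_sym Num.Theory.pnatr_eq0 => /eqP k0.
by have := allP s1 _ ks; rewrite k0.
Qed.

(** The degree of each of [v] and [w] is that of the other one minus a natural
    number, so they agree, and the eigenspace of that degree is the line of [v].
    The vector [w'] is meant to be a homogeneous component of [w], when [w] itself
    is not known to generate the space. *)
Lemma hw_vectors_proportional lam mu v w :
    hw_vector lam v -> hw_vector mu w ->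
    (forall u, line_and_below (hw_degree lam) v u) ->
    (exists2 w', hw_vector mu w' & forall u, line_and_below (hw_degree mu) w' u) ->
  exists e : K, w = e *: v.
Proof.
move=> vH wH vU [w' wH' wU].
have Dv := grading_hw vH; have Dw := grading_hw wH; have Dw' := grading_hw wH'.
have [v0 _ _] := vH; have [w0 _ _] := wH.
have [k ek] := line_and_below_eigen Dv w0 Dw (vU w).
have [l el] := line_and_below_eigen Dw' v0 Dv (wU v).
have k0 : k = 0%N.
  have : (k + l)%:R == 0 :> K.
    rewrite natrD -(inj_eq (addrI (hw_degree lam))) addr0 {1}el ek.
    by rewrite [k%:R + _]addrC addrA subrK subrK.
  by rewrite Num.Theory.pnatr_eq0 addn_eq0 => /andP[/eqP].
apply: (line_and_below_top Dv _ (vU w)).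
by rewrite Dw ek k0 subr0.
Qed.

End HighestWeight.

(** * Graded representations *)

Section Superspace.
Variables (K : fieldType) (V : superspace K).
Implicit Types (u v : V) (f : 'End(V)).

Lemma spart_decomp u : exists v j, v \in spart V j /\ u - v \in spart V (~~ j).
Proof.
have := memvf u; rewrite -(spart_sum V) => /memv_addP[x xV [y yV ->]].
by exists x, false; rewrite addrC addKr.
Qed.

(** The images under [f] of the two homogeneous components of [u] have
    different parities, so they cannot cancel unless both vanish. *)
Lemma homogeneous_ker f (i : bool) j u v :
    (forall k w, w \in spart V k -> f w \in spart V (i (+) k)) ->
    v \in spart V j -> u - v \in spart V (~~ j) -> f u = 0 -> f v = 0.
Proof.
move=> fV vV uV fu0; apply/eqP; rewrite -memv0 -(spart_cap V) memv_cap.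
have fv1 := fV _ _ vV.
have fv2 : f v \in spart V (i (+) ~~ j).
  have -> : f v = - f (u - v) by rewrite linearB /= fu0 sub0r opprK.
  by rewrite rpredN fV.
by move: fv1 fv2; case: i {fV}; case: j {vV uV} => /= -> ->.
Qed.

End Superspace.

Section SuperRep.
Variables (K : fieldType) (M N p : nat) (V : superspace K).
Variable rho : super_rep M N p V.
Implicit Types (a b c d : 'I_(M + N)) (u v w : V).

Definition gen_op a b n : 'End(V) := rho (WT K p a b n).

Lemma gen_op_action : yangian_action gen_op.
Proof.
apply: (Trhs_action (repM rho)) => a b m c d n m0 n0.
rewrite -(Tcomm_morph (@yangT K M N) (qproj (@trunc_proper K M N p))).
by rewrite -(Trhs_morph (@yangT K M N) (qproj (@trunc_proper K M N p))) yangTP.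
Qed.

Lemma gen_op_parity a b n j v : v \in spart V j ->
  gen_op a b n v \in spart V (odd (par a + par b) (+) j).
Proof.
apply: rep_even; exists (freeT K a b n) => // w.
rewrite /freeT /free_gen msuppU oner_eq0 inE => /eqP ->.
by rewrite fmU big_seq1.
Qed.

Lemma act_parity s j v : v \in spart V j -> exists k, act gen_op s v \in spart V k.
Proof.
move=> vV; elim: s => [|g s [k IH]]; first by exists j.
by exists (odd (par g.1.1 + par g.1.2) (+) k); apply: gen_op_parity.
Qed.

Definition free_proj : {lrmorphism free_alg K (Tindex M N) -> Walg K M N p} :=
  qproj (@trunc_proper K M N p) \o qproj (@yangian_proper K M N).

Lemma rho_monomial (s : {fmonom Tindex M N}) u :
  rho (free_proj (<< s >> : free_alg K (Tindex M N))) u = act gen_op s u.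
Proof.
case: s => s; elim: s u => [|g s IH] u.
  have -> : (<< FMonom [::] >> : free_alg K (Tindex M N)) = 1.
    by rewrite -fmoneE.
  by rewrite rmorph1 rep1 lfunE.
have -> : (<< FMonom (g :: s) >> : free_alg K (Tindex M N))
    = free_gen K g * << FMonom s >>.
  rewrite /free_gen malgM_def fgmulUU mulr1; congr << _ *g _ >>.
  by rewrite fmuE; apply/eqP; rewrite fmP fmM.
rewrite rmorphM repM comp_lfunE IH /=.
by case: g => [[a b] k].
Qed.

(** This is the cyclic submodule generated by [v], the algebra being spanned by
    the words in the generators; words are homogeneous, which makes its grading
    visible. *)
Inductive cyclic_span v : V -> Prop :=
| cyclic_span0 : cyclic_span v 0
| cyclic_spanS (e : K) s u : cyclic_span v u -> cyclic_span v (e *: act gen_op s v + u).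

Lemma cyclic_span_lin v : lin_closed (cyclic_span v).
Proof.
split=> [|c u w uP wP]; first exact: cyclic_span0.
elim: uP => [|e s x _ IH]; first by rewrite scaler0 add0r.
by rewrite scalerDr scalerA -addrA; apply: cyclic_spanS.
Qed.

Lemma cyclic_span_act v s : cyclic_span v (act gen_op s v).
Proof.
rewrite -[act _ _ _]scale1r -[X in cyclic_span _ X]addr0.
exact/cyclic_spanS/cyclic_span0.
Qed.

Lemma cyclic_span_rho v x u : cyclic_span v u -> cyclic_span v (rho x u).
Proof.
elim=> [|e s w _ IH]; first by rewrite linear0; apply: cyclic_span0.
rewrite lfunZD; apply: (cyclic_span_lin v).2 => // {IH w}.
have [f ->] : exists f, x = free_proj f.
  exists (qrepr (qrepr x)); by rewrite /= !qreprK.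
rewrite [f]monalgE (linear_sum free_proj) (linear_sum rho) sum_lfunE.
apply: lin_closed_sum => [|k _].
  exact: cyclic_span_lin.
have -> : << f@_k *g k >> = f@_k *: (<< k >> : free_alg K (Tindex M N)).
  by apply/malgP => k'; rewrite mcoeffZ !mcoeffU mulrnAr mulr1.
rewrite (linearZZ free_proj) (linearZZ rho) lfun_simp rho_monomial; apply: lin_closedZ.
  exact: cyclic_span_lin.
by rewrite -act_cat; apply: cyclic_span_act.
Qed.

(** Words send the homogeneous vector [v] to homogeneous vectors, so the cyclic
    submodule of [v] is graded and irreducibility applies to it. *)
Lemma irreducible_cyclic j v : irreducible_rep rho ->
  v != 0 -> v \in spart V j -> forall u, cyclic_span v u.
Proof.
move=> [_ irr] v0 vV; have [U UP] := vspace_of_pred (cyclic_span_lin v).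
have vU : v \in U by apply/UP/(cyclic_span_act v [::]).
have [|U0|UV u] := irr U.
- split=> [|x].
    apply/vspaceP => u; apply/idP/idP; last first.
      by move=> /memv_addP[x /memv_capP[xU _] [y /memv_capP[yU _] ->]]; apply: rpredD.
    move/UP; elim=> [|e s x _ IH]; first exact: mem0v.
    rewrite memvD // memvZ //; have [k sk] := act_parity s vV.
    have sU : act gen_op s v \in U by apply/UP/cyclic_span_act.
    case: k sk => sk; first by apply: (subvP (addvSr _ _)); rewrite memv_cap sU.
    by apply: (subvP (addvSl _ _)); rewrite memv_cap sU.
  by apply/subvP => _ /memv_imgP[u /UP uU ->]; apply/UP/cyclic_span_rho.
- by move: vU v0; rewrite U0 memv0 => ->.
by apply/UP; rewrite UV memvf.
Qed.

End SuperRep.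

Section HighestWeightRep.
Variables (K : numClosedFieldType) (M N p : nat) (V : superspace K).
Variable rho : super_rep M N p V.
Implicit Types (v w : V).
Local Notation gen_op := (gen_op rho).

(** The raising generators, and the differences of diagonal generators and
    their eigenvalues, are odd or even operators that kill [w]. *)
Lemma hw_component lam w : hw_vector gen_op lam w ->
  exists j v, v \in spart V j /\ hw_vector gen_op lam v.
Proof.
move=> [w0 wP wD].
suff comp j v : v \in spart V j -> w - v \in spart V (~~ j) -> v != 0 ->
    hw_vector gen_op lam v.
  have [v [j [vV uV]]] := spart_decomp w.
  have [vz|v0] := eqVneq v 0; last by exists j, v; split=> //; apply: comp vV uV v0.
  exists (~~ j), w; split; last by split.
  by rewrite vz subr0 in uV.
move=> vV uV v0; split=> // [a b r ab r0|a r r0].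
  apply: (homogeneous_ker (gen_op_parity rho a b r) vV uV); exact: wP.
apply/eqP; rewrite -subr_eq0; apply/eqP.
have fE x : (gen_op a a r - lam a r *: \1%VF) x = gen_op a a r x - lam a r *: x.
  by rewrite !lfun_simp.
rewrite -fE; apply: (homogeneous_ker (i := false) _ vV uV) => [k x xV|].
  rewrite fE /= rpredB ?memvZ //.
  by have := gen_op_parity rho a a r xV; rewrite oddD addbb.
by rewrite fE wD // subrr.
Qed.

Lemma is_hw_vectorP v : is_hw_vector rho v <-> exists lam, hw_vector gen_op lam v.
Proof.
by split=> [[v0 vP [lam vD]]|[lam [v0 vP vD]]]; [exists lam | split=> //; exists lam].
Qed.

End HighestWeightRep.

Unset Implicit Arguments.

Theorem theorem4p6 (R : realType) (M N p : nat)
    (hM : (1 <= M)%N) (hN : (1 <= N)%N) (hp : (1 <= p)%N)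
    (V : superspace R[i]) (rho : super_rep M N p V) :
  irreducible_rep rho ->
  highest_weight_rep rho
  /\ exists v, is_hw_vector rho v
       /\ forall w, is_hw_vector rho w -> exists c : R[i], w = c *: v.
Proof.
move=> irr; have rel := gen_op_action rho.
have [lam0 [v0 v0H]] := ex_hw_vector rel irr.1.
have [j [v [vV vH]]] := hw_component v0H.
have below mu i x : x \in spart V i -> hw_vector (gen_op rho) mu x ->
    forall u, line_and_below (gen_op rho) (hw_degree mu) x u.
  move=> xV xH u; have [x0 _ _] := xH.
  have lin := line_and_below_lin (gen_op rho) (hw_degree mu) x.
  elim: (irreducible_cyclic irr x0 xV u) => [|e s y _ IH]; first by case: lin.
  by apply: lin.2 => //; apply: hw_words_below.
have vhw : is_hw_vector rho v by apply/is_hw_vectorP; exists lam0.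
split; first by exists v.
exists v; split=> // w /is_hw_vectorP[mu wH].
apply: (hw_vectors_proportional vH wH (below _ _ _ vV vH)).
by have [i [w' [w'V w'H]]] := hw_component wH; exists w' => //; apply: below w'V w'H.
Qed.
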